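(* Let $\mathcal{C}$ be a well-powered semi-abelian category with joins. Then $\mathcal{C}$ has normal cores if and only if in $\mathcal{C}$ joins of normal subobjects are normal.
   Context: A semi-abelian category is a pointed, Barr exact, protomodular category with binary coproducts. A normal subobject $N\lhd X$ is a subobject represented by the kernel of some morphism. ''With joins'' means that every small family $(U_i\leq X)_{i\in I}$ of subobjects of any object $X$ has a join $\bigvee_{i\in I}U_i\leq X$, the smallest subobject of $X$ containing all $U_i$. ''Joins of normal subobjects are normal'' means that for each object $X$ and each small family of normal subobjects $(N_i\lhd X)_{i\in I}$, the join $\bigvee_{i\in I}N_i$ is a normal subobject of $X$. Given a subobject $S\leq X$, a normal core of $S\leq X$ is a normal subobject $N\lhd X$ with $N\leq S$ which is terminal (largest) amongst all $M\lhd X$ such that $M\leq S$. $\mathcal{C}$ has normal cores when each subobject $S\leq X$ in $\mathcal{C}$ has a normal core. *)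

(* Defs.v *)
From Stdlib Require Import List FinFun.

Set Implicit Arguments.
Unset Strict Implicit.
Unset Printing Implicit Defensive.

(** "Small" means: living in one fixed but arbitrary universe.  Hom-sets are
    small; the collection of objects lives in an independent universe. *)
Definition small := Type.

Record Category := {
  Ob :> Type;
  hom : Ob -> Ob -> small;
  id : forall X, hom X X;
  comp : forall X Y Z, hom Y Z -> hom X Y -> hom X Z;
  comp_id_l : forall X Y (f : hom X Y), comp (id Y) f = f;
  comp_id_r : forall X Y (f : hom X Y), comp f (id X) = f;
  comp_assoc : forall W X Y Z (h : hom Y Z) (g : hom X Y) (f : hom W X),
    comp h (comp g f) = comp (comp h g) f
}.

Arguments hom {c} X Y.
Arguments id {c} X.
Arguments comp {c X Y Z} g f.

Notation "g ∘ f" := (comp g f) (at level 40, left associativity).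

Definition mono (C : Category) (X Y : C) (m : hom X Y) : Prop :=
  forall (W : C) (f g : hom W X), m ∘ f = m ∘ g -> f = g.

(** ** Finite limits *)

Record Functor (J C : Category) := {
  fobj :> J -> C;
  fmap : forall i j : J, hom i j -> hom (fobj i) (fobj j);
  fmap_id : forall i : J, fmap (id i) = id (fobj i);
  fmap_comp : forall (i j k : J) (b : hom j k) (a : hom i j),
    fmap (b ∘ a) = fmap b ∘ fmap a
}.

Arguments fmap {J C} f {i j} a.

Definition is_cone (J C : Category) (D : Functor J C) (L : C)
    (p : forall i : J, hom L (D i)) : Prop :=
  forall (i j : J) (a : hom i j), fmap D a ∘ p i = p j.

Definition is_limit (J C : Category) (D : Functor J C) (L : C)
    (p : forall i : J, hom L (D i)) : Prop :=
  is_cone p /\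
  forall (W : C) (q : forall i : J, hom W (D i)), is_cone q ->
    exists! u : hom W L, forall i : J, p i ∘ u = q i.

Definition finite_category (J : Category) : Prop :=
  Finite J /\ forall i j : J, Finite (hom i j).

Definition finitely_complete (C : Category) : Prop :=
  forall (J : Category) (D : Functor J C), finite_category J ->
    exists (L : C) (p : forall i : J, hom L (D i)), is_limit p.

(** The square [f ∘ p = g ∘ q] is a pullback. *)
Definition is_pullback (C : Category) (X Y Z P : C)
    (f : hom X Z) (g : hom Y Z) (p : hom P X) (q : hom P Y) : Prop :=
  f ∘ p = g ∘ q /\
  forall (W : C) (a : hom W X) (b : hom W Y), f ∘ a = g ∘ b ->
    exists! u : hom W P, p ∘ u = a /\ q ∘ u = b.

(** ** Pointed categories and kernels *)

Definition is_initial (C : Category) (I : C) : Prop :=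
  forall X : C, exists! f : hom I X, True.

Definition is_terminal (C : Category) (T : C) : Prop :=
  forall X : C, exists! f : hom X T, True.

Definition is_zero_object (C : Category) (Z : C) : Prop :=
  is_initial Z /\ is_terminal Z.

Definition pointed (C : Category) : Prop := exists Z : C, is_zero_object Z.

Definition is_zero_morphism (C : Category) (X Y : C) (f : hom X Y) : Prop :=
  exists (Z : C) (a : hom X Z) (b : hom Z Y), is_zero_object Z /\ f = b ∘ a.

Definition is_kernel (C : Category) (K X Y : C) (f : hom X Y) (k : hom K X)
    : Prop :=
  is_zero_morphism (f ∘ k) /\
  forall (W : C) (h : hom W X), is_zero_morphism (f ∘ h) ->
    exists! u : hom W K, k ∘ u = h.

(** ** Barr exact categories *)

Definition is_coequalizer (C : Category) (R X Q : C) (r0 r1 : hom R X)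
    (q : hom X Q) : Prop :=
  q ∘ r0 = q ∘ r1 /\
  forall (W : C) (h : hom X W), h ∘ r0 = h ∘ r1 ->
    exists! u : hom Q W, u ∘ q = h.

Definition regular_epi (C : Category) (X Y : C) (q : hom X Y) : Prop :=
  exists (R : C) (r0 r1 : hom R X), is_coequalizer r0 r1 q.

Definition is_kernel_pair (C : Category) (R X Y : C) (f : hom X Y)
    (r0 r1 : hom R X) : Prop := is_pullback f f r0 r1.

Record regular_category (C : Category) : Prop := {
  regular_finite_limits : finitely_complete C;
  regular_coequalizers : forall (R X Y : C) (f : hom X Y) (r0 r1 : hom R X),
    is_kernel_pair f r0 r1 ->
    exists (Q : C) (q : hom X Q), is_coequalizer r0 r1 q;
  regular_epi_stable : forall (X Y Z P : C) (f : hom X Z) (g : hom Y Z)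
    (p : hom P X) (q : hom P Y),
    is_pullback f g p q -> regular_epi f -> regular_epi q
}.

(** Internal equivalence relations; for transitivity, [P] is the object of
    pairs [(x,y), (y,z)] in [R]. *)
Record equivalence_relation (C : Category) (R X : C) (r0 r1 : hom R X)
    : Prop := {
  eqrel_jointly_monic : forall (W : C) (f g : hom W R),
    r0 ∘ f = r0 ∘ g -> r1 ∘ f = r1 ∘ g -> f = g;
  eqrel_refl : exists d : hom X R, r0 ∘ d = id X /\ r1 ∘ d = id X;
  eqrel_sym : exists s : hom R R, r0 ∘ s = r1 /\ r1 ∘ s = r0;
  eqrel_trans : forall (P : C) (p q : hom P R), is_pullback r1 r0 p q ->
    exists t : hom P R, r0 ∘ t = r0 ∘ p /\ r1 ∘ t = r1 ∘ q
}.

Record barr_exact (C : Category) : Prop := {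
  exact_regular : regular_category C;
  exact_effective : forall (R X : C) (r0 r1 : hom R X),
    equivalence_relation r0 r1 ->
    exists (Y : C) (f : hom X Y), is_kernel_pair f r0 r1
}.

(** ** Protomodular categories *)

Record Point (C : Category) (Y : C) := {
  pt_obj : C;
  pt_proj : hom pt_obj Y;
  pt_sect : hom Y pt_obj;
  pt_split : pt_proj ∘ pt_sect = id Y
}.

Definition point_morphism (C : Category) (Y : C) (P Q : Point Y)
    (f : hom (pt_obj P) (pt_obj Q)) : Prop :=
  pt_proj Q ∘ f = pt_proj P /\ f ∘ pt_sect P = pt_sect Q.

Definition point_iso (C : Category) (Y : C) (P Q : Point Y)
    (f : hom (pt_obj P) (pt_obj Q)) : Prop :=
  point_morphism f /\
  exists g : hom (pt_obj Q) (pt_obj P),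
    point_morphism g /\ g ∘ f = id (pt_obj P) /\ f ∘ g = id (pt_obj Q).

(** [a] exhibits [P'] as the change of base of [P] along [v], that is, [a] is
    a cartesian arrow over [v] in the fibration of points. *)
Definition change_of_base (C : Category) (Y' Y : C) (v : hom Y' Y)
    (P' : Point Y') (P : Point Y) (a : hom (pt_obj P') (pt_obj P)) : Prop :=
  is_pullback (pt_proj P) v a (pt_proj P') /\
  a ∘ pt_sect P' = pt_sect P ∘ v.

(** The change-of-base functor [v^* : Pt(Y) -> Pt(Y')] reflects isomorphisms,
    for every [v : Y' -> Y].  Below, [f'] is the value of [v^*] at [f],
    computed with an arbitrary choice of pullbacks.  The existence of these
    pullbacks is required as well. *)
Record protomodular (C : Category) : Prop := {
  proto_change_of_base : forall (Y' Y : C) (v : hom Y' Y) (P : Point Y),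
    exists (P' : Point Y') (a : hom (pt_obj P') (pt_obj P)),
      change_of_base v a;
  proto_conservative : forall (Y' Y : C) (v : hom Y' Y) (P Q : Point Y)
    (P' Q' : Point Y')
    (a : hom (pt_obj P') (pt_obj P)) (b : hom (pt_obj Q') (pt_obj Q))
    (f : hom (pt_obj P) (pt_obj Q)) (f' : hom (pt_obj P') (pt_obj Q')),
    change_of_base v a -> change_of_base v b ->
    point_morphism f -> point_morphism f' -> b ∘ f' = f ∘ a ->
    point_iso f' -> point_iso f
}.

(** ** Semi-abelian categories *)

Definition is_coproduct (C : Category) (X Y S : C) (i : hom X S) (j : hom Y S)
    : Prop :=
  forall (W : C) (f : hom X W) (g : hom Y W),
    exists! u : hom S W, u ∘ i = f /\ u ∘ j = g.

Definition has_binary_coproducts (C : Category) : Prop :=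
  forall X Y : C, exists (S : C) (i : hom X S) (j : hom Y S), is_coproduct i j.

Record semi_abelian (C : Category) : Prop := {
  semi_abelian_pointed : pointed C;
  semi_abelian_exact : barr_exact C;
  semi_abelian_protomodular : protomodular C;
  semi_abelian_coproducts : has_binary_coproducts C
}.

(** ** Subobjects *)

(** A subobject is given by a representing monomorphism; two of them are the
    same subobject when they are related by [sub_equiv].  All notions below
    are invariant under [sub_equiv]. *)
Record Subobject (C : Category) (X : C) := {
  sub_obj : C;
  sub_arr : hom sub_obj X;
  sub_mono : mono sub_arr
}.

Definition sub_le (C : Category) (X : C) (S T : Subobject X) : Prop :=
  exists u : hom (sub_obj S) (sub_obj T), sub_arr T ∘ u = sub_arr S.

Definition sub_equiv (C : Category) (X : C) (S T : Subobject X) : Prop :=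
  sub_le S T /\ sub_le T S.

Definition normal (C : Category) (X : C) (N : Subobject X) : Prop :=
  exists (Y : C) (f : hom X Y), is_kernel f (sub_arr N).

Definition well_powered (C : Category) : Prop :=
  forall X : C, exists (I : small) (S : I -> Subobject X),
    forall T : Subobject X, exists i : I, sub_equiv (S i) T.

Definition is_join (C : Category) (X : C) (I : small) (U : I -> Subobject X)
    (J : Subobject X) : Prop :=
  (forall i : I, sub_le (U i) J) /\
  forall T : Subobject X, (forall i : I, sub_le (U i) T) -> sub_le J T.

Definition has_joins (C : Category) : Prop :=
  forall (X : C) (I : small) (U : I -> Subobject X),
    exists J : Subobject X, is_join U J.

Definition joins_of_normal_are_normal (C : Category) : Prop :=
  forall (X : C) (I : small) (N : I -> Subobject X) (J : Subobject X),
    (forall i : I, normal (N i)) -> is_join N J -> normal J.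

Definition is_normal_core (C : Category) (X : C) (S N : Subobject X) : Prop :=
  normal N /\ sub_le N S /\
  forall M : Subobject X, normal M -> sub_le M S -> sub_le M N.

Definition has_normal_cores (C : Category) : Prop :=
  forall (X : C) (S : Subobject X), exists N : Subobject X, is_normal_core S N.

(* Main.v *)
Require Import Defs.

(** The statement is order-theoretic: in the preorder of subobjects of [X], the
    normal core of [S] is the largest normal subobject below [S].

    Suppose that normal cores exist and that [J] is the join of normal
    subobjects.  Each of them lies below [J], hence below the core of [J];
    therefore [J] itself lies below its core, so that [J] is its own core and
    thus normal.

    Conversely, the core of [S] is the join of all normal subobjects below [S].
    This join is normal by hypothesis.  Well-poweredness is what makes the
    family small: a small family of representatives of all subobjects of [X] is
    restricted to the indices of those that are normal and lie below [S].

    Both arguments replace a subobject by an equivalent one, so they rest on the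
    invariance of normality under equivalence, [normal_equiv]. *)

Lemma sub_le_trans (C : Category) (X : C) (R S T : Subobject X) :
  sub_le R S -> sub_le S T -> sub_le R T.
Proof.
  intros [u Hu] [v Hv]. exists (v ∘ u).
  now rewrite comp_assoc, Hv.
Qed.

Lemma zero_morphism_precomp (C : Category) (W X Y : C) (f : hom X Y)
    (g : hom W X) :
  is_zero_morphism f -> is_zero_morphism (f ∘ g).
Proof.
  intros (Z & a & b & HZ & ->). exists Z, (a ∘ g), b.
  split; [exact HZ | now rewrite comp_assoc].
Qed.

(** A kernel is determined only up to isomorphism over [X]: the same morphism
    has either representative as its kernel. *)
Lemma normal_equiv (C : Category) (X : C) (M N : Subobject X) :
  sub_equiv M N -> normal N -> normal M.
Proof.
  intros [[u Hu] [v Hv]] (Y & f & Hzero & Huniv). exists Y, f. split.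
  - rewrite <- Hu, comp_assoc. now apply zero_morphism_precomp.
  - intros W h Hh. destruct (Huniv W h Hh) as (w & Hw & _).
    assert (Hvw : sub_arr M ∘ (v ∘ w) = h)
      by now rewrite comp_assoc, Hv.
    exists (v ∘ w). split; [exact Hvw |].
    intros w' Hw'. apply (sub_mono (s := M)). now rewrite Hvw, Hw'.
Qed.

Lemma join_of_normal_normal_of_core (C : Category) (X : C) (I : small)
    (N : I -> Subobject X) (J K : Subobject X) :
  (forall i, normal (N i)) -> is_join N J -> is_normal_core J K -> normal J.
Proof.
  intros HN [Hub Hleast] (HK & HKJ & Hmax).
  apply normal_equiv with K; [| exact HK].
  split; [| exact HKJ].
  apply Hleast. intros i. now apply Hmax.
Qed.

Lemma normal_core_of_joins (C : Category) (Hwp : well_powered C)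
    (Hjoins : has_joins C) (Hnormal : joins_of_normal_are_normal C)
    (X : C) (S : Subobject X) :
  exists N : Subobject X, is_normal_core S N.
Proof.
  destruct (Hwp X) as (I & U & HU).
  pose (V := fun i : {i : I | normal (U i) /\ sub_le (U i) S} =>
               U (proj1_sig i)).
  destruct (Hjoins X _ V) as [N HN]. exists N.
  split; [| split].
  - apply (Hnormal X _ V N); [| exact HN].
    intros [i [Hi HiS]]. exact Hi.
  - apply HN. intros [i [Hi HiS]]. exact HiS.
  - intros M HM HMS. destruct (HU M) as [i [HiM HMi]].
    assert (Hi : normal (U i) /\ sub_le (U i) S).
    { split.
      - now apply normal_equiv with M.
      - now apply sub_le_trans with M. }
    apply sub_le_trans with (U i); [exact HMi |].
    exact (proj1 HN (exist _ i Hi)).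
Qed.

Theorem proposition6p6 (C : Category) (HC : semi_abelian C)
    (Hwp : well_powered C) (Hjoins : has_joins C) :
  has_normal_cores C <-> joins_of_normal_are_normal C.
Proof.
  split.
  - intros Hcores X I N J HN HJ. destruct (Hcores X J) as [K HK].
    exact (join_of_normal_normal_of_core _ _ _ _ _ _ HN HJ HK).
  - intros Hnormal X S. now apply normal_core_of_joins.
Qed.
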